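(* Let $p$ be a prime. The lattice of all $p$-minor subsets of $\mathbb{N}_0$ (with operations intersection and union) is isomorphic to the lattice of all linearly closed clonoids on $\mathbb{Z}_p$ (with operations intersection and sum).
   Context: $\mathbb{N}=\{1,2,3,\dots\}$, $\mathbb{N}_0=\mathbb{N}\cup\{0\}$. For a prime $p$, a set $M\subseteq\mathbb{N}_0$ is a $p$-minor subset if $n-(p-1)\in M$ for all $n\in M$ with $n>p-1$. All operations considered have arity $n\in\mathbb{N}$ (so $n\ge 1$). For a set $E$ of finitary operations, $E^{[n]}$ denotes its $n$-ary members. For sets $E,F$ of finitary operations on $\mathbb{Z}_p$, $EF:=\{f(g_1,\dots,g_n)\mid n,m\in\mathbb{N},\ f\in E^{[n]},\ g_1,\dots,g_n\in F^{[m]}\}$. The set $\mathcal{L}_{\mathbb{Z}_p}$ of linear functions on $\mathbb{Z}_p$ is the clone generated by the binary operation $+$. A nonempty set $C$ of finitary operations on $\mathbb{Z}_p$ is a linearly closed clonoid on $\mathbb{Z}_p$ if $\mathcal{L}_{\mathbb{Z}_p}C\subseteq C$ and $C\mathcal{L}_{\mathbb{Z}_p}\subseteq C$. The sum of two linearly closed clonoids is $D_1+D_2:=\{f+g\mid n\in\mathbb{N},\ f\in D_1^{[n]},\ g\in D_2^{[n]}\}$; it is the smallest linearly closed clonoid containing $D_1$ and $D_2$. *)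

(* Defs.v *)
From HB Require Import structures.
From mathcomp Require Import all_boot all_order all_algebra.
From mathcomp Require Import boolp classical_sets.

Set Implicit Arguments.
Unset Strict Implicit.
Unset Printing Implicit Defensive.

Import Order.TTheory GRing.Theory.
Import SetOrder.Exports.

Local Open Scope classical_set_scope.
Local Open Scope ring_scope.

Fact clonoid_display : Order.disp_t.
Proof. exact: Order.Disp tt tt. Qed.

Section MinorSubsets.
Variable p : nat.
Implicit Types M N : set nat.

Definition is_minor_subset M : Prop :=
  forall n : nat, M n -> (p.-1 < n)%N -> M (n - p.-1)%N.

Lemma is_minor_subsetI M N :
  is_minor_subset M -> is_minor_subset N -> is_minor_subset (M `&` N).
Proof. by move=> hM hN n [Mn Nn] lt; split; [exact: hM | exact: hN]. Qed.

Lemma is_minor_subsetU M N :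
  is_minor_subset M -> is_minor_subset N -> is_minor_subset (M `|` N).
Proof. by move=> hM hN n [Mn|Nn] lt; [left; exact: hM | right; exact: hN]. Qed.

Record minor_subset := MinorSubset {
  minor_subset_set :> set nat;
  minor_subset_subproof : `[< is_minor_subset minor_subset_set >] }.

HB.instance Definition _ := [isSub for minor_subset_set].
HB.instance Definition _ := [Choice of minor_subset by <:].
HB.instance Definition _ :=
  [SubChoice_isSubPOrder of minor_subset by <: with clonoid_display].

Lemma minor_subsetP (M : minor_subset) : is_minor_subset M.
Proof. exact/asboolP/minor_subset_subproof. Qed.

Definition minor_subsetI (M N : minor_subset) : minor_subset :=
  MinorSubset (asboolT (is_minor_subsetI (@minor_subsetP M) (@minor_subsetP N))).

Definition minor_subsetU (M N : minor_subset) : minor_subset :=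
  MinorSubset (asboolT (is_minor_subsetU (@minor_subsetP M) (@minor_subsetP N))).

Lemma le_minor_subset_meet (L M N : minor_subset) :
  (L <= minor_subsetI M N)%O = (L <= M)%O && (L <= N)%O.
Proof. by rewrite !leEsub -lexI meetEset. Qed.

Lemma minor_subset_join_le (L M N : minor_subset) :
  (minor_subsetU L M <= N)%O = (L <= N)%O && (M <= N)%O.
Proof. by rewrite !leEsub -leUx joinEset. Qed.

HB.instance Definition _ :=
  @Order.POrder_MeetJoin_isLattice.Build clonoid_display minor_subset
    minor_subsetI minor_subsetU le_minor_subset_meet minor_subset_join_le.

End MinorSubsets.

Section Operations.
Variable p : nat.

(* 'F_p is Z/pZ only for prime p: in general it is Z/(pdiv p)Z. *)
Definition operation (n : nat) := {ffun 'rV['F_p]_n -> 'F_p}.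

(* Arities are at least 1, hence the index shift. *)
Definition finop := {n : nat & operation n.+1}.

Definition FinOp (n : nat) (f : operation n.+1) : finop :=
  existT (fun n => operation n.+1) n f.

Implicit Types (C D E F : set finop).

Definition projection (n : nat) (i : 'I_n) : operation n :=
  [ffun x : 'rV_n => x 0 i].

Definition add_operation : operation 2 :=
  [ffun x : 'rV_2 => x 0 0 + x 0 1].

Definition comp_operation (n m : nat) (f : operation n)
    (g : 'I_n -> operation m) : operation m :=
  [ffun x => f (\row_i g i x)].

Definition comp_set E F : set finop :=
  [set h | exists (n m : nat) (f : operation n.+1)
                  (g : 'I_n.+1 -> operation m.+1),
     [/\ E (FinOp f), (forall i, F (FinOp (g i))) &
         h = FinOp (comp_operation f g)]].

Definition is_clone E : Prop :=
  (forall (n : nat) (i : 'I_n.+1), E (FinOp (projection i))) /\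
  comp_set E E `<=` E.

Definition linear_operations : set finop :=
  smallest is_clone [set FinOp add_operation].

Definition is_linearly_closed_clonoid C : Prop :=
  [/\ C !=set0, comp_set linear_operations C `<=` C &
      comp_set C linear_operations `<=` C].

Definition sum_set C D : set finop :=
  [set h | exists (n : nat) (f g : operation n.+1),
     [/\ C (FinOp f), D (FinOp g) & h = FinOp (f + g)]].

Lemma FinOp_inj (n : nat) : injective (@FinOp n).
Proof. by move=> f g /eqP; rewrite /FinOp eq_Tagged => /eqP. Qed.

Lemma is_clone_linear : is_clone linear_operations.
Proof.
split=> [n i E [[Ep _] _]|_ [n [m [f [g [Ef Eg ->]]]]] E EP]; first exact: Ep.
have [[_ EE] _] := EP; apply: EE; exists n, m, f, g; split=> // [|i].
  exact: Ef.
exact: Eg.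
Qed.

Lemma linear_add : linear_operations (FinOp add_operation).
Proof. exact: sub_gen_smallest. Qed.

Definition additive_operations : set finop :=
  [set h : finop |
    let: existT _ f := h in forall x y, f (x + y) = f x + f y].

Lemma linear_additive : linear_operations `<=` additive_operations.
Proof.
apply: smallest_sub => [|_ -> x y /=]; last first.
  by rewrite !ffunE !mxE addrACA.
split=> [n i x y|_ [n [m [f [g [Ef Eg ->]]]]] x y] /=; first by rewrite !ffunE mxE.
rewrite !ffunE -Ef; congr (f _); apply/rowP => i; rewrite !mxE.
exact: Eg.
Qed.

Lemma clonoid_comp2 C : is_linearly_closed_clonoid C ->
  forall (n : nat) (f g : operation n.+1),
  C (FinOp f) -> C (FinOp g) -> C (FinOp (f + g)).
Proof.
move=> [_ LC _] n f g Cf Cg; apply: LC.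
exists 1%N, n, add_operation, (fun i => if i == 0 then f else g).
split=> [|i|]; [exact: linear_add | by case: ifP | congr FinOp].
by apply/ffunP => x; rewrite !ffunE !mxE.
Qed.

Lemma clonoid_mulrn C : is_linearly_closed_clonoid C ->
  forall (n : nat) (f : operation n.+1) k,
  C (FinOp f) -> C (FinOp (f *+ k.+1)).
Proof.
move=> hC n f; elim=> [|k IH] Cf; first by rewrite mulr1n.
by rewrite mulrS; apply: clonoid_comp2 => //; exact: IH.
Qed.

Lemma clonoid_zero C (n : nat) :
  is_linearly_closed_clonoid C -> C (FinOp (0 : operation n.+1)).
Proof.
move=> hC; have [[[m f] Cf] _ CL] := hC.
have Ch : C (FinOp (comp_operation f (fun=> projection (ord0 : 'I_n.+1)))).
  apply: CL; exists m, n, f, (fun=> projection ord0); split=> //= _.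
  by case: is_clone_linear.
have -> : 0 = comp_operation f (fun=> projection (ord0 : 'I_n.+1))
                *+ (Zp_trunc (pdiv p)).+2.
  apply/ffunP => x; rewrite ffunMnE [LHS]ffunE -mulr_natr.
  suff -> : (Zp_trunc (pdiv p)).+2%:R = 0 :> 'F_p by rewrite mulr0.
  by apply/val_inj; rewrite Zp_nat /= modnn.
exact: clonoid_mulrn.
Qed.

Lemma is_linearly_closed_clonoidI C D :
  is_linearly_closed_clonoid C -> is_linearly_closed_clonoid D ->
  is_linearly_closed_clonoid (C `&` D).
Proof.
move=> hC hD; split.
- by exists (FinOp (0 : operation 1)); split; exact: clonoid_zero.
- move=> _ [n [m [f [g [Lf CDg ->]]]]]; have [_ LC _] := hC; have [_ LD _] := hD.
  split; [apply: LC | apply: LD]; exists n, m, f, g; split=> // i;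
    by case: (CDg i).
- move=> _ [n [m [f [g [[Cf Df] Lg ->]]]]]; have [_ _ CL] := hC.
  have [_ _ DL] := hD.
  by split; [apply: CL | apply: DL]; exists n, m, f, g; split.
Qed.

Lemma sum_setP C D (n : nat) (h : operation n.+1) :
  sum_set C D (FinOp h) ->
  exists fg : operation n.+1 * operation n.+1,
    [/\ C (FinOp fg.1), D (FinOp fg.2) & h = fg.1 + fg.2].
Proof.
case=> m [f [g [Cf Dg e]]].
have mn : n = m := congr1 (@projT1 _ _) e.
by subst m; exists (f, g); split=> //; exact: FinOp_inj.
Qed.

Lemma is_linearly_closed_clonoidD C D :
  is_linearly_closed_clonoid C -> is_linearly_closed_clonoid D ->
  is_linearly_closed_clonoid (sum_set C D).
Proof.
move=> hC hD; split.
- exists (FinOp (0 + 0 : operation 1)), 0%N, 0, 0.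
  by split=> //; exact: clonoid_zero.
- move=> _ [n [m [f [g [Lf /= CDg ->]]]]].
  have [_ LC _] := hC; have [_ LD _] := hD.
  have [fg fgP] := choice (fun i => sum_setP (CDg i)).
  exists m, (comp_operation f (fun i => (fg i).1)),
            (comp_operation f (fun i => (fg i).2)); split.
  + apply: LC; exists n, m, f, (fun i => (fg i).1); split=> // i.
    by case: (fgP i).
  + apply: LD; exists n, m, f, (fun i => (fg i).2); split=> // i.
    by case: (fgP i).
  + congr FinOp; apply/ffunP => x; rewrite !ffunE.
    rewrite -[RHS](linear_additive Lf (\row_i _) (\row_i _)) /=; congr (f _).
    by apply/rowP => i; rewrite !mxE; have [_ _ ->] := fgP i; rewrite ffunE.
- move=> _ [n [m [f [g [/sum_setP [[f1 f2] /= [Cf1 Df2 ->]] Lg ->]]]]].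
  have [_ _ CL] := hC; have [_ _ DL] := hD.
  exists m, (comp_operation f1 g), (comp_operation f2 g); split.
  + by apply: CL; exists n, m, f1, g.
  + by apply: DL; exists n, m, f2, g.
  + by congr FinOp; apply/ffunP => x; rewrite !ffunE.
Qed.

Record linearly_closed_clonoid := LinearlyClosedClonoid {
  clonoid_set :> set finop;
  clonoid_subproof : `[< is_linearly_closed_clonoid clonoid_set >] }.

HB.instance Definition _ := [isSub for clonoid_set].
HB.instance Definition _ := [Choice of linearly_closed_clonoid by <:].
HB.instance Definition _ :=
  [SubChoice_isSubPOrder of linearly_closed_clonoid by <:
     with clonoid_display].

Lemma linearly_closed_clonoidP (C : linearly_closed_clonoid) :
  is_linearly_closed_clonoid C.
Proof. exact/asboolP/clonoid_subproof. Qed.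

Definition clonoidI (C D : linearly_closed_clonoid) : linearly_closed_clonoid :=
  LinearlyClosedClonoid (asboolT (is_linearly_closed_clonoidI
    (linearly_closed_clonoidP C) (linearly_closed_clonoidP D))).

Definition clonoidD (C D : linearly_closed_clonoid) : linearly_closed_clonoid :=
  LinearlyClosedClonoid (asboolT (is_linearly_closed_clonoidD
    (linearly_closed_clonoidP C) (linearly_closed_clonoidP D))).

Lemma le_clonoid_meet (B C D : linearly_closed_clonoid) :
  (B <= clonoidI C D)%O = (B <= C)%O && (B <= D)%O.
Proof. by rewrite !leEsub -lexI meetEset. Qed.

Lemma clonoid_join_le (B C D : linearly_closed_clonoid) :
  (clonoidD B C <= D)%O = (B <= D)%O && (C <= D)%O.
Proof.
rewrite !leEsub; apply/idP/andP; rewrite !subsetEset /=.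
  move=> sD; split=> -[n f] h; apply: sD.
    exists n, f, 0; rewrite addr0; split=> //.
    exact: (clonoid_zero n (linearly_closed_clonoidP C)).
  exists n, 0, f; rewrite add0r; split=> //.
  exact: (clonoid_zero n (linearly_closed_clonoidP B)).
move=> [BD CD] _ [n [f [g [Bf Cg ->]]]].
by apply: (clonoid_comp2 (linearly_closed_clonoidP D)); [exact: BD | exact: CD].
Qed.

HB.instance Definition _ :=
  @Order.POrder_MeetJoin_isLattice.Build clonoid_display
    linearly_closed_clonoid clonoidI clonoidD le_clonoid_meet clonoid_join_le.

End Operations.

Lemma minor_subset_meetE p (M N : minor_subset p) :
  (M `&` N)%O = M `&` N :> set nat.
Proof. by []. Qed.

Lemma minor_subset_joinE p (M N : minor_subset p) :
  (M `|` N)%O = M `|` N :> set nat.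
Proof. by []. Qed.

Lemma clonoid_meetE p (C D : linearly_closed_clonoid p) :
  (C `&` D)%O = C `&` D :> set (finop p).
Proof. by []. Qed.

Lemma clonoid_joinE p (C D : linearly_closed_clonoid p) :
  (C `|` D)%O = sum_set C D :> set (finop p).
Proof. by []. Qed.

(* Main.v *)
Require Import Defs.
From HB Require Import structures.
From mathcomp Require Import all_boot all_order all_algebra.
From mathcomp Require Import boolp classical_sets.
From mathcomp Require Import zify finfield.
Import Order.Theory GRing.Theory.

(** Every operation on Z_p is a unique combination of reduced monomials, those
with all exponents below p. Call degree of such a monomial the sum of its
exponents. The isomorphism sends a p-minor subset M to the set of operations
whose reduced monomials all have their degree in M ([degree_clonoid]).

This set is a clonoid ([degree_clonoidP]): substituting linear forms into a
monomial of degree d gives a combination of possibly non-reduced monomials of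
degree d, and each reduction step x^p = x lowers the degree by p - 1, from a
value above p - 1; this is exactly what M is closed under.

Conversely a clonoid D is determined by the degrees of the monomials it
contains, for three reasons. First, D contains every reduced monomial that
occurs in one of its members ([clonoid_monomial]): rescaling the variables by
all vectors a and combining the results with suitable weights isolates one
monomial ([coeff_extraction]). Second, it then contains all reduced monomials
of that degree, in every arity ([clonoid_monomial_degree]): replacing x_i by
x_i + x_j in x^m produces the monomial with one unit of exponent moved from i
to j, with coefficient m_i, which is nonzero mod p; such moves connect all
reduced exponent vectors with the same sum, and a change of arity is a matter
of dummy variables. Third, if d > p - 1 is one of its degrees, so is d - (p - 1)
([clonoid_degree_drop]): identify two variables in
x_0^(p-1) x_1 ... x_(d-p+1). Hence M |-> degree_clonoid M is onto, and it
reflects inclusion because x_1 ... x_d lies in degree_clonoid M only if d lies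
in M. *)

Set Implicit Arguments.
Unset Strict Implicit.
Unset Printing Implicit Defensive.

Local Open Scope classical_set_scope.
Local Open Scope ring_scope.

(** * Exponent vectors *)

Section ExponentVectors.

Definition shift_expo n (m : 'I_n -> nat) (i j : 'I_n) (k : nat) : 'I_n -> nat :=
  fun l => if l == i then (m i - k)%N else if l == j then (m j + k)%N else m l.

Lemma sum_shift_expo n (m : 'I_n -> nat) (i j : 'I_n) :
  i != j -> (0 < m i)%N -> (\sum_l shift_expo m i j 1 l = \sum_l m l)%N.
Proof.
move=> ij mi; rewrite (bigD1 i) //= (bigD1 j) 1?eq_sym //=.
rewrite [RHS](bigD1 i) //= [X in (_ = _ + X)%N](bigD1 j) 1?eq_sym //=.
rewrite /shift_expo eqxx [j == i]eq_sym (negPf ij) eqxx.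
rewrite (eq_bigr m) => [|l /andP[/negPf-> /negPf->] //]; lia.
Qed.

Lemma eq_sum_leq n (m m' : 'I_n -> nat) :
  (forall i, m i <= m' i)%N -> (\sum_i m i = \sum_i m' i)%N -> m =1 m'.
Proof.
move=> le /eqP; have [_ ->] := leqif_sum (fun i (_ : true) => leqif_eq (le i)).
by move=> /forallP mm i; apply/eqP; exact: mm.
Qed.

Definition pad_expo n n' (m : 'I_n -> nat) (m' : 'I_n' -> nat) :
    'I_(n + n') -> nat :=
  fun l => match split l with inl i => m i | inr j => m' j end.

Lemma pad_expol n n' (m : 'I_n -> nat) (m' : 'I_n' -> nat) i :
  pad_expo m m' (lshift n' i) = m i.
Proof. by rewrite /pad_expo (unsplitK (inl i)). Qed.

Lemma pad_expor n n' (m : 'I_n -> nat) (m' : 'I_n' -> nat) j :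
  pad_expo m m' (rshift n j) = m' j.
Proof. by rewrite /pad_expo (unsplitK (inr j)). Qed.

End ExponentVectors.

(** * The prime field and its power functions *)

Section PrimeField.
Variables (p : nat) (p_prime : prime p).

Lemma mulrn_Fp (x c : 'F_p) : x *+ c = x * c.
Proof. by rewrite -mulr_natr natr_Zp. Qed.

Lemma ltn_Fp (k : 'F_p) : (k < p)%N.
Proof. by rewrite -[X in (_ < X)%N](Fp_cast p_prime) ltn_ord. Qed.

Lemma inZp_Fp_eq k l : (k < p)%N -> (l < p)%N ->
  (inZp k == inZp l :> 'F_p) = (k == l).
Proof. by move=> kp lp; rewrite -val_eqE /= (Fp_cast p_prime) !modn_small. Qed.

Lemma Fp_expp (x : 'F_p) : x ^+ p = x.
Proof. by rewrite -[X in x ^+ X](card_Fp p_prime) expf_card. Qed.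

(** An element of the field is its own exponent here: the reduced exponents
0, ..., p - 1 are exactly the canonical representatives of the field, so that
reduced exponent vectors form a finite type. *)
Definition expo n (e : {ffun 'I_n -> 'F_p}) : 'I_n -> nat := fun i => e i.

Definition fin_expo n (m : 'I_n -> nat) : {ffun 'I_n -> 'F_p} :=
  [ffun i => inZp (m i)].

Lemma fin_expoK n (m : 'I_n -> nat) :
  (forall i, m i < p)%N -> expo (fin_expo m) =1 m.
Proof.
by move=> mp i; rewrite /expo ffunE /= (Fp_cast p_prime) modn_small.
Qed.

End PrimeField.

Section PowerBasis.
Variable p : nat.

Definition pow_mx : 'M['F_p]_((Zp_trunc (pdiv p)).+2) :=
  Vandermonde _ (\row_(a < (Zp_trunc (pdiv p)).+2) (a : 'F_p)).

(** The linear functionals dual to the basis of power functions 1, x, ...,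
x^(p-1): the coefficient of x^k in g is the sum over a of [pow_dual k a * g a]. *)
Definition pow_dual (k a : 'F_p) : 'F_p := invmx pow_mx a k.

Lemma pow_mx_unit : pow_mx \in unitmx.
Proof.
rewrite unitmxE unitfE det_Vandermonde; apply/prodf_neq0 => i _.
apply/prodf_neq0 => j ij; rewrite !mxE subr_eq0.
by apply: contraTneq ij => ->; rewrite ltnn.
Qed.

Lemma sum_pow_dual (k l : 'F_p) :
  \sum_a pow_dual k a * a ^+ l = (k == l)%:R.
Proof.
have /matrixP /(_ l k) := mulmxV pow_mx_unit.
rewrite !mxE eq_sym => <-; apply: eq_bigr => a _.
by rewrite !mxE mulrC.
Qed.

Lemma sum_pow_dual_interp (a b : 'F_p) :
  \sum_k pow_dual k a * b ^+ k = (a == b)%:R.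
Proof.
have /matrixP /(_ a b) := mulVmx pow_mx_unit.
by rewrite !mxE => <-; apply: eq_bigr => k _; rewrite !mxE.
Qed.

End PowerBasis.

(** * Coefficients of an operation *)

Section Coefficients.
Variable p : nat.

Definition monomial n (m : 'I_n -> nat) : operation p n :=
  [ffun x : 'rV_n => \prod_i x 0 i ^+ m i].

(** The coefficient of the reduced monomial x^e, as a tensor product of the
one-variable functionals. *)
Definition coeff n (e : {ffun 'I_n -> 'F_p}) (f : operation p n) : 'F_p :=
  \sum_(a : 'rV_n) (\prod_i pow_dual (e i) (a 0 i)) * f a.

Lemma eq_monomial n (m m' : 'I_n -> nat) :
  m =1 m' -> monomial m = monomial m'.
Proof.
by move=> mm; apply/ffunP => x; rewrite !ffunE; apply: eq_bigr => i _; rewrite mm.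
Qed.

Lemma monomial_add_var n (m : 'I_n -> nat) (i j : 'I_n) (x : 'rV['F_p]_n) :
  i != j ->
  monomial m (\row_l (if l == i then x 0 i + x 0 j else x 0 l)) =
  \sum_(k < (m i).+1) monomial (shift_expo m i j k) x *+ 'C(m i, k).
Proof.
move=> ij; rewrite ffunE (bigD1 i) //= (bigD1 j) 1?eq_sym //=.
rewrite !mxE eqxx eq_sym (negPf ij) exprDn mulr_suml; apply: eq_bigr => k _.
rewrite ffunE [in RHS](bigD1 i) //= [in RHS](bigD1 j) 1?eq_sym //=.
rewrite /shift_expo eqxx [j == i]eq_sym (negPf ij) eqxx mulrnAl -!mulrA.
congr (_ * _ *+ _).
rewrite mulrA -exprD addnC; congr (_ * _); apply: eq_bigr => l /andP[li lj].
by rewrite mxE (negPf li) (negPf lj).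
Qed.

(** The tensor product over the variables of [sum_pow_dual_interp]. *)
Lemma sum_monomial_dual n (a x : 'rV['F_p]_n) :
  \sum_(e : {ffun 'I_n -> 'F_p})
     monomial (expo e) x * \prod_i pow_dual (e i) (a 0 i) = (a == x)%:R.
Proof.
transitivity (\prod_i \sum_(k : 'F_p) pow_dual k (a 0 i) * x 0 i ^+ k).
  rewrite bigA_distr_bigA; apply: eq_bigr => e _; rewrite ffunE -big_split.
  by apply: eq_bigr => i _; rewrite mulrC.
under eq_bigr => i _ do rewrite sum_pow_dual_interp.
have [->|/eqP/rowP ax] := eqVneq a x; first by apply: big1 => i _; rewrite eqxx.
have [i ai] : exists i, a 0 i != x 0 i.
  by apply/existsP; apply: contra_notT ax => /existsPn ax i;
     apply/eqP; move: (ax i); rewrite negbK.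
by rewrite (bigD1 i) //= (negPf ai) mul0r.
Qed.

(** Scalars are written as natural multiples, a field element being coerced to
its representative, because that is how linear operations act on a clonoid. *)
Lemma interpolation n (f : operation p n) :
  f = \sum_(e : {ffun 'I_n -> 'F_p}) monomial (expo e) *+ coeff e f.
Proof.
apply/ffunP => x; rewrite sum_ffunE.
under eq_bigr => e _ do rewrite ffunMnE mulrn_Fp /coeff mulr_sumr.
rewrite exchange_big /=.
under eq_bigr => a _ do under eq_bigr => e _ do rewrite mulrA.
under eq_bigr => a _ do rewrite -mulr_suml sum_monomial_dual.
rewrite (bigD1 x) //= eqxx mul1r big1 ?addr0 // => a ax.
by rewrite (negPf ax) mul0r.
Qed.

Lemma coeff_monomial n (e : {ffun 'I_n -> 'F_p}) (m : 'I_n -> nat) :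
  coeff e (monomial m) = \prod_i \sum_a pow_dual (e i) a * a ^+ m i.
Proof.
rewrite bigA_distr_bigA /coeff.
rewrite (reindex (fun h : {ffun 'I_n -> 'F_p} => \row_i h i)).
  apply: eq_bigr => h _; rewrite ffunE -big_split.
  by apply: eq_bigr => i _; rewrite mxE.
exists (fun a : 'rV_n => [ffun i => a 0 i]) => [h|a] _.
  by apply/ffunP => i; rewrite !ffunE mxE.
by apply/rowP => i; rewrite mxE ffunE.
Qed.

Lemma coeff_reduced_monomial n (e e' : {ffun 'I_n -> 'F_p}) :
  coeff e (monomial (expo e')) = (e == e')%:R.
Proof.
rewrite coeff_monomial; have [->|/eqP/ffunP ee'] := eqVneq e e'.
  by apply: big1 => i _; rewrite sum_pow_dual eqxx.
have [i ei] : exists i, e i != e' i.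
  by apply/existsP; apply: contra_notT ee' => /existsPn ee' i;
     apply/eqP; move: (ee' i); rewrite negbK.
by rewrite (bigD1 i) //= sum_pow_dual (negPf ei) mul0r.
Qed.

Lemma coeffD n (e : {ffun 'I_n -> 'F_p}) (f g : operation p n) :
  coeff e (f + g) = coeff e f + coeff e g.
Proof. by rewrite -big_split; apply: eq_bigr => a _; rewrite ffunE mulrDr. Qed.

Lemma coeff0 n (e : {ffun 'I_n -> 'F_p}) : coeff e 0 = 0.
Proof. by apply: big1 => a _; rewrite ffunE mulr0. Qed.

Lemma coeffMn n (e : {ffun 'I_n -> 'F_p}) (f : operation p n) k :
  coeff e (f *+ k) = coeff e f *+ k.
Proof. by elim: k => [|k IH]; rewrite ?mulr0n ?coeff0 // !mulrSr coeffD IH. Qed.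

Lemma coeff_sum n (e : {ffun 'I_n -> 'F_p}) I (r : seq I) (P : pred I)
    (F : I -> operation p n) :
  coeff e (\sum_(i <- r | P i) F i) = \sum_(i <- r | P i) coeff e (F i).
Proof. exact: (big_morph _ (coeffD e) (coeff0 e)). Qed.

(** Rescaling the variables by a multiplies x^e' by a^e'; the weights of the
functional [coeff e] then annihilate all terms of f but the one of x^e. *)
Lemma coeff_extraction n (e : {ffun 'I_n -> 'F_p}) (f : operation p n) :
  monomial (expo e) *+ coeff e f =
  \sum_(a : 'rV_n) [ffun x : 'rV_n => f (\row_i (a 0 i * x 0 i))] *+
     (\prod_i pow_dual (e i) (a 0 i) : 'F_p)%R.
Proof.
apply/ffunP => x; rewrite sum_ffunE ffunMnE mulrn_Fp.
pose g (e' : {ffun 'I_n -> 'F_p}) (a : 'rV_n) : 'F_p :=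
  (\prod_i pow_dual (e i) (a 0 i)) * monomial (expo e') a.
transitivity (\sum_(a : 'rV_n) \sum_(e' : {ffun 'I_n -> 'F_p})
    g e' a * (monomial (expo e') x * coeff e' f)); last first.
  apply: eq_bigr => a _; rewrite ffunMnE mulrn_Fp ffunE.
  rewrite [in RHS](interpolation f) sum_ffunE mulrC mulr_sumr.
  apply: eq_bigr => e' _; rewrite ffunMnE mulrn_Fp /g -mulrA; congr (_ * _).
  rewrite !mulrA; congr (_ * _); rewrite !ffunE -big_split.
  by apply: eq_bigr => i _; rewrite mxE exprMn.
rewrite exchange_big /=.
under eq_bigr => e' _ do
  rewrite -mulr_suml -[X in X * _]/(coeff e (monomial (expo e')))
  coeff_reduced_monomial.
rewrite (bigD1 e) //= eqxx mul1r big1 ?addr0 // => e' ne.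
by rewrite eq_sym (negPf ne) mul0r.
Qed.

End Coefficients.

(** * Monomials contained in a clonoid *)

Section LinearOperations.
Variable p : nat.

Lemma additive_sum n (f : operation p n) :
  (forall x y, f (x + y) = f x + f y) ->
  forall x, f x = \sum_i x 0 i * f (delta_mx 0 i).
Proof.
move=> fD x.
have f0 : f 0 = 0 by apply: (@addrI _ (f 0)); rewrite -fD !addr0.
have fZ (c : 'F_p) v : f (c *: v) = c * f v.
  rewrite -[in LHS](natr_Zp c) scaler_nat.
  rewrite -[in RHS](natr_Zp c) mulr_natl; elim: (c : nat) => [|k IH] //.
  by rewrite !mulrS fD IH.
rewrite [in LHS](row_sum_delta x) (big_morph _ fD f0).
by apply: eq_bigr => i _; rewrite fZ.
Qed.

Lemma linear_operations_clonoid :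
  is_linearly_closed_clonoid (@linear_operations p).
Proof.
have [_ LL] := is_clone_linear p.
by split=> //; exists (FinOp (@add_operation p)); exact: linear_add.
Qed.

Lemma linear_proj n (i : 'I_n.+1) : linear_operations (FinOp (@projection p _ i)).
Proof. by case: (is_clone_linear p). Qed.

End LinearOperations.

Section ClonoidClosure.
Variables (p : nat) (D : set (finop p)).
Hypothesis clD : is_linearly_closed_clonoid D.

Lemma clonoid_muln n (f : operation p n.+1) k :
  D (FinOp f) -> D (FinOp (f *+ k)).
Proof. by case: k => [|k] Df; [exact: clonoid_zero | exact: clonoid_mulrn]. Qed.

Lemma clonoid_divn n (f : operation p n.+1) (c : 'F_p) :
  prime p -> c != 0 -> D (FinOp (f *+ c)) -> D (FinOp f).
Proof.
move=> pp c0 /(clonoid_muln (c^-1 : 'F_p)%R) Df; congr (D (FinOp _)): Df.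
by apply/ffunP => x; rewrite !ffunMnE !mulrn_Fp mulfK.
Qed.

Lemma clonoid_sum n I (r : seq I) (P : pred I) (F : I -> operation p n.+1) :
  (forall i, P i -> D (FinOp (F i))) -> D (FinOp (\sum_(i <- r | P i) F i)).
Proof.
move=> DF; apply: (big_ind (fun f => D (FinOp f))) => //.
  exact: clonoid_zero.
by move=> f g; exact: clonoid_comp2.
Qed.

Lemma clonoid_subst n m (f : operation p n.+1) (g : 'I_n.+1 -> operation p m.+1) :
  D (FinOp f) -> (forall i, linear_operations (FinOp (g i))) ->
  D (FinOp (comp_operation f g)).
Proof. by move=> Df Lg; case: clD => _ _; apply; exists n, m, f, g. Qed.

(** Renaming, identifying and adding dummy variables. *)
Lemma clonoid_reindex n m (f : operation p n.+1) (s : 'I_n.+1 -> 'I_m.+1) :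
  D (FinOp f) -> D (FinOp [ffun x : 'rV_m.+1 => f (\row_i x 0 (s i))]).
Proof.
move=> Df; have := clonoid_subst (g := fun i => @projection p _ (s i)) Df.
move=> /(_ (fun i => linear_proj (s i))) => {}Df; congr (D (FinOp _)): Df.
apply/ffunP => x; rewrite !ffunE; congr (f _).
by apply/rowP => i; rewrite !mxE ffunE.
Qed.

End ClonoidClosure.

Section MonomialsOfClonoid.
Variables (p : nat) (D : set (finop p)).
Hypotheses (p_prime : prime p) (clD : is_linearly_closed_clonoid D).

Lemma linear_scale n (a : 'F_p) (i : 'I_n.+1) :
  linear_operations (FinOp [ffun x : 'rV['F_p]_n.+1 => a * x 0 i]).
Proof.
have := clonoid_muln (linear_operations_clonoid p) a (linear_proj i).
congr (linear_operations (FinOp _)); apply/ffunP => x.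
by rewrite ffunMnE mulrn_Fp !ffunE mulrC.
Qed.

Lemma clonoid_monomial n (f : operation p n.+1) (e : {ffun 'I_n.+1 -> 'F_p}) :
  D (FinOp f) -> coeff e f != 0 -> D (FinOp (monomial p (expo e))).
Proof.
move=> Df ef; apply: (clonoid_divn clD p_prime ef); rewrite coeff_extraction.
apply: clonoid_sum => // a _; apply: clonoid_muln => //.
have := clonoid_subst clD Df (fun i => linear_scale (a 0 i) i).
congr (D (FinOp _)); apply/ffunP => x; rewrite !ffunE; congr (f _).
by apply/rowP => i; rewrite !mxE ffunE.
Qed.

(** Substitute x_i + x_j for x_i: the shifted monomial appears with coefficient
m_i, and no other term of the binomial expansion reduces to it, since they
all differ from it in the exponent of x_i, which stays below p. *)
Lemma clonoid_shift n (m : 'I_n.+1 -> nat) (i j : 'I_n.+1) :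
  i != j -> (forall l, m l < p)%N -> (0 < m i)%N -> ((m j).+1 < p)%N ->
  D (FinOp (monomial p m)) -> D (FinOp (monomial p (shift_expo m i j 1))).
Proof.
move=> ij mp mi mj Dm; pose m1 := shift_expo m i j 1.
have m1p l : (m1 l < p)%N.
  rewrite /m1 /shift_expo; case: eqP => _.
    exact: leq_ltn_trans (leq_subr _ _) (mp i).
  by case: eqP => _; rewrite ?addn1.
rewrite -[shift_expo _ _ _ _]/m1 -(eq_monomial p (fin_expoK p_prime m1p)).
pose g l : operation p n.+1 := if l == i then @projection p _ i + projection p j
  else @projection p _ l.
apply: (@clonoid_monomial _ (comp_operation (monomial p m) g)).
  apply: (clonoid_subst clD) => // l; rewrite /g.
  case: eqP => _; last exact: linear_proj.
  apply: (clonoid_comp2 (linear_operations_clonoid p)); exact: linear_proj.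
have -> : comp_operation (monomial p m) g =
    \sum_(k < (m i).+1) monomial p (shift_expo m i j k) *+ 'C(m i, k).
  apply/ffunP => x; rewrite sum_ffunE ffunE.
  under [RHS]eq_bigr => k _ do rewrite ffunMnE.
  rewrite -monomial_add_var //; congr (monomial p m _).
  apply/rowP => l; rewrite !mxE /g; case: eqP => _; by rewrite !ffunE.
rewrite coeff_sum.
have m1i : (1 < (m i).+1)%N by [].
rewrite (bigD1 (Ordinal m1i)) //= big1 ?addr0 => [|k k1].
  rewrite coeffMn bin1 -/m1 -(eq_monomial p (fin_expoK p_prime m1p)).
  rewrite coeff_reduced_monomial eqxx.
  by rewrite -(dvdn_pcharf (pchar_Fp p_prime)) gtnNdvd.
rewrite coeffMn coeff_monomial (bigD1 i) //= ffunE.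
have kp : (m i - k < p)%N by exact: leq_ltn_trans (leq_subr _ _) (mp i).
have -> : shift_expo m i j k i = (inZp (m i - k) : 'F_p).
  by rewrite /shift_expo eqxx /= (Fp_cast p_prime) modn_small.
rewrite sum_pow_dual inZp_Fp_eq // /m1 /shift_expo eqxx.
case: eqP => [e|_]; last by rewrite mul0r mul0rn.
case/eqP: k1; apply/val_inj => /=; have := ltn_ord k; lia.
Qed.

(** As long as the vectors differ, some m_i exceeds m'_i and some m_j is below
m'_j; shifting one unit from i to j lowers the total excess. The exponent m_j + 1
stays reduced because it is at most m'_j. *)
Lemma clonoid_monomial_connect n (m m' : 'I_n.+1 -> nat) :
  (forall i, m i < p)%N -> (forall i, m' i < p)%N ->
  (\sum_i m i = \sum_i m' i)%N ->
  D (FinOp (monomial p m)) -> D (FinOp (monomial p m')).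
Proof.
move=> + m'p; have [k] := ubnP (\sum_i (m i - m' i))%N.
elim: k m => // k IH m; rewrite ltnS => mk mp smm' Dm.
have [/forallP le|] := boolP [forall i, m i <= m' i]%N.
  by rewrite -(eq_monomial p (eq_sum_leq le smm')).
rewrite negb_forall => /existsP[i]; rewrite -ltnNge => m'i.
have [j mj] : exists j, (m j < m' j)%N.
  apply/existsP; apply: contraLR m'i => /existsPn ge; rewrite -leqNgt.
  by rewrite (@eq_sum_leq _ m' m) // => l; rewrite leqNgt ge.
have ij : i != j by apply: contraTneq m'i => ->; rewrite -leqNgt ltnW.
have mi : (0 < m i)%N by exact: leq_trans m'i.
apply: (IH (shift_expo m i j 1)) => [|l||].
- apply: leq_trans mk; rewrite (bigD1 i) //= [X in (_ < X)%N](bigD1 i) //=.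
  rewrite -addSn; apply: leq_add; first by rewrite /shift_expo eqxx; lia.
  rewrite /shift_expo; apply: leq_sum => l li; rewrite (negPf li).
  by case: eqP => [->|_] //; lia.
- rewrite /shift_expo; case: eqP => _.
    exact: leq_ltn_trans (leq_subr _ _) (mp i).
  by case: eqP => // _; rewrite addn1; exact: leq_ltn_trans (m'p j).
- by rewrite sum_shift_expo.
- by apply: clonoid_shift => //; exact: leq_ltn_trans (m'p j).
Qed.

(** To change the arity, let both monomials live on disjoint blocks of variables
of a common arity, where the previous lemma applies. *)
Lemma clonoid_monomial_degree n n' (m : 'I_n.+1 -> nat) (m' : 'I_n'.+1 -> nat) :
  (forall i, m i < p)%N -> (forall i, m' i < p)%N ->
  (\sum_i m i = \sum_i m' i)%N ->
  D (FinOp (monomial p m)) -> D (FinOp (monomial p m')).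
Proof.
move=> mp m'p smm' Dm; have p0 := prime_gt0 p_prime.
have {}Dm := clonoid_reindex clD (@lshift n.+1 n'.+1) Dm.
pose ml : 'I_(n.+1 + n'.+1) -> nat := pad_expo m (fun=> 0)%N.
pose mr : 'I_(n.+1 + n'.+1) -> nat := pad_expo (fun=> 0)%N m'.
have {Dm}Dl : D (FinOp (monomial p (ml : 'I_(n + n'.+1).+1 -> nat))).
  congr (D (FinOp _)): Dm; apply/ffunP => x; rewrite !ffunE.
  rewrite (@big_split_ord _ _ _ n.+1 n'.+1) /= [X in _ * X]big1 ?mulr1 => [|i _].
    by apply: eq_bigr => i _; rewrite mxE /ml pad_expol.
  by rewrite /ml pad_expor expr0.
have {Dl}Dr : D (FinOp (monomial p (mr : 'I_(n + n'.+1).+1 -> nat))).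
  apply: clonoid_monomial_connect Dl => [i|i|]; rewrite ?/ml ?/mr ?/pad_expo.
  - by case: split.
  - by case: split.
  - rewrite !(@big_split_ord _ _ _ n.+1 n'.+1) /= .
    rewrite [X in (_ + X = _)%N]big1 => [|i _]; last first.
      by rewrite (unsplitK (inr i)).
    rewrite [X in (_ = X + _)%N]big1 => [|i _]; last first.
      by rewrite (unsplitK (inl i)).
    rewrite addn0 add0n.
    under eq_bigr => i _ do rewrite (unsplitK (inl i)).
    by under [RHS]eq_bigr => i _ do rewrite (unsplitK (inr i)).
(* the left block holds dummy variables, which may go anywhere *)
pose s (l : 'I_(n.+1 + n'.+1)) : 'I_n'.+1 :=
  match split l with inl _ => ord0 | inr j => j end.
have := clonoid_reindex clD (s : 'I_(n + n'.+1).+1 -> _) Dr.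
congr (D (FinOp _)); apply/ffunP => x; rewrite !ffunE.
rewrite (@big_split_ord _ _ _ n.+1 n'.+1) /= big1 ?mul1r => [|i _].
  by apply: eq_bigr => i _; rewrite mxE /s (unsplitK (inr i)) /mr pad_expor.
by rewrite /mr pad_expol expr0.
Qed.

(** Let d be the degree of m and k = d - p. Identifying x_0 and x_1 in
x_0^(p-1) x_1 ... x_(k+1), of degree d, yields a factor x_0^p = x_0, hence a
product of k + 1 distinct variables. *)
Lemma clonoid_degree_drop n n' (m : 'I_n.+1 -> nat) (m' : 'I_n'.+1 -> nat) :
  (forall i, m i < p)%N -> (forall i, m' i < p)%N ->
  (p.-1 < \sum_i m i)%N -> (\sum_i m' i = \sum_i m i - p.-1)%N ->
  D (FinOp (monomial p m)) -> D (FinOp (monomial p m')).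
Proof.
move=> mp m'p dp sm' Dm; have p1 := prime_gt1 p_prime.
pose k := (\sum_i m i - p)%N.
pose m1 : 'I_k.+2 -> nat := fun i => if i == ord0 then p.-1 else 1%N.
(* merges the first two variables: 0 and 1 go to 0, i.+1 goes to i *)
pose s (i : 'I_k.+2) : 'I_k.+1 := odflt ord0 (unlift ord0 i).
have s0 : s ord0 = ord0 by rewrite /s unlift_none.
have sl j : s (lift ord0 j) = j by rewrite /s liftK.
have m10 : m1 ord0 = p.-1 by [].
have m1l j : m1 (lift ord0 j) = 1%N by [].
have m1p i : (m1 i < p)%N.
  by rewrite /m1; case: eqP => _ //; rewrite prednK // ltnW.
have sm1 : (\sum_i m i = \sum_i m1 i)%N.
  rewrite [RHS]big_ord_recl m10; under [X in (_ = _ + X)%N]eq_bigr do rewrite m1l.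
  by rewrite sum1_card card_ord /k; lia.
have Dm1 := clonoid_monomial_degree mp m1p sm1 Dm.
have := clonoid_reindex clD s Dm1.
have -> : [ffun x : 'rV_k.+1 => monomial p m1 (\row_i x 0 (s i))] =
          monomial p (fun _ : 'I_k.+1 => 1%N).
  apply/ffunP => x; rewrite !ffunE big_ord_recl mxE s0 m10.
  rewrite big_ord_recl [RHS]big_ord_recl mulrA mxE sl m1l -exprD.
  rewrite addn1 prednK ?(ltnW p1) //.
  rewrite (Fp_expp p_prime) expr1; congr (_ * _); apply: eq_bigr => i _.
  by rewrite mxE sl m1l.
apply: clonoid_monomial_degree => //.
by rewrite sm' sum1_card card_ord /k; lia.
Qed.

End MonomialsOfClonoid.

(** * Homogeneous operations *)

Section HomogeneousOperations.
Variables (p n : nat).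
Implicit Types f g : operation p n.

(** The span of the monomials of total degree d with arbitrary, possibly
non-reduced, exponents. By x^p = x, an operation can be homogeneous of several
degrees; in exchange, degrees add up under multiplication. *)
Inductive homogeneous : nat -> operation p n -> Prop :=
| homogeneous0 d : homogeneous d 0
| homogeneousD d f g : homogeneous d f -> homogeneous d g -> homogeneous d (f + g)
| homogeneous_monomial m : homogeneous (\sum_i m i)%N (monomial p m).

Lemma homogeneousMn d f k : homogeneous d f -> homogeneous d (f *+ k).
Proof.
move=> hf; elim: k => [|k IH]; first exact: homogeneous0.
by rewrite mulrSr; apply: homogeneousD.
Qed.

Lemma homogeneous_sum d I (r : seq I) (P : pred I) (F : I -> operation p n) :
  (forall i, P i -> homogeneous d (F i)) ->
  homogeneous d (\sum_(i <- r | P i) F i).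
Proof.
move=> hF; apply: big_ind => //; first exact: homogeneous0.
by move=> f g; exact: homogeneousD.
Qed.

Lemma homogeneousM d d' f g : homogeneous d f -> homogeneous d' g ->
  homogeneous (d + d') [ffun x => f x * g x].
Proof.
move=> hf; elim: hf d' g => {d f} [d|d f1 f2 _ IH1 _ IH2|m] d' g hg.
- have -> : [ffun x => (0 : operation p n) x * g x] = 0.
    by apply/ffunP => x; rewrite !ffunE mul0r.
  exact: homogeneous0.
- have -> : [ffun x => (f1 + f2) x * g x] =
            [ffun x => f1 x * g x] + [ffun x => f2 x * g x].
    by apply/ffunP => x; rewrite !ffunE mulrDl.
  by apply: homogeneousD; [exact: IH1 | exact: IH2].
elim: hg => {d' g} [d|d f1 f2 _ IH1 _ IH2|m'].
- have -> : [ffun x => monomial p m x * (0 : operation p n) x] = 0.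
    by apply/ffunP => x; rewrite !ffunE mulr0.
  exact: homogeneous0.
- have -> : [ffun x => monomial p m x * (f1 + f2) x] =
            [ffun x => monomial p m x * f1 x] + [ffun x => monomial p m x * f2 x].
    by apply/ffunP => x; rewrite !ffunE mulrDr.
  exact: homogeneousD.
have -> : [ffun x => monomial p m x * monomial p m' x] =
          monomial p (fun i => m i + m' i)%N.
  apply/ffunP => x; rewrite !ffunE -big_split.
  by apply: eq_bigr => i _; rewrite exprD.
by rewrite -big_split; exact: homogeneous_monomial.
Qed.

Lemma homogeneous_cst1 : homogeneous 0 [ffun=> 1].
Proof.
have -> : [ffun=> 1] = monomial p (fun _ : 'I_n => 0%N).
  by apply/ffunP => x; rewrite !ffunE big1.
by have := homogeneous_monomial (fun=> 0%N); rewrite big1.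
Qed.

Lemma homogeneousX f k : homogeneous 1 f -> homogeneous k [ffun x => f x ^+ k].
Proof.
move=> hf; elim: k => [|k IH]; first exact: homogeneous_cst1.
have -> : [ffun x => f x ^+ k.+1] = [ffun x => f x * [ffun x => f x ^+ k] x].
  by apply/ffunP => x; rewrite !ffunE exprS.
exact: (homogeneousM hf IH).
Qed.

Lemma homogeneous_prod I (r : seq I) (k : I -> nat) (F : I -> operation p n) :
  (forall i, homogeneous (k i) (F i)) ->
  homogeneous (\sum_(i <- r) k i) [ffun x => \prod_(i <- r) F i x].
Proof.
move=> hF; elim: r => [|i r IH].
  rewrite big_nil; congr (homogeneous _ _): homogeneous_cst1.
  by apply/ffunP => x; rewrite !ffunE big_nil.
rewrite big_cons; have := homogeneousM (hF i) IH.
by congr (homogeneous _ _); apply/ffunP => x; rewrite !ffunE big_cons.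
Qed.

Lemma homogeneous_additive f :
  (forall x y, f (x + y) = f x + f y) -> homogeneous 1 f.
Proof.
move=> fD.
have -> : f = \sum_i monomial p (fun j => (j == i) : nat) *+ (f (delta_mx 0 i)).
  apply/ffunP => x; rewrite sum_ffunE (additive_sum fD).
  apply: eq_bigr => i _; rewrite ffunMnE mulrn_Fp ffunE; congr (_ * _).
  by rewrite (bigD1 i) //= eqxx expr1 big1 ?mulr1 // => j /negPf ->.
apply: homogeneous_sum => i _; apply: homogeneousMn.
have := homogeneous_monomial (fun j => (j == i) : nat).
by rewrite (bigD1 i) //= eqxx big1 // => j /negPf ->.
Qed.

End HomogeneousOperations.

(** * The clonoid of a minor subset *)

Section DegreeClonoid.
Variables (p : nat) (p_prime : prime p).
Implicit Type M : set nat.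

Definition degree_clonoid M : set (finop p) :=
  [set h : finop p | let: existT n f := h in
     forall e : {ffun 'I_n.+1 -> 'F_p}, coeff e f != 0 -> M (\sum_i expo e i)%N].

Lemma degree_clonoid0 M n : degree_clonoid M (FinOp (0 : operation p n.+1)).
Proof. by move=> e; rewrite coeff0 eqxx. Qed.

Lemma degree_clonoidD M n (f g : operation p n.+1) :
  degree_clonoid M (FinOp f) -> degree_clonoid M (FinOp g) ->
  degree_clonoid M (FinOp (f + g)).
Proof.
move=> Mf Mg e; rewrite coeffD.
have [f0|/Mf//] := eqVneq (coeff e f) 0; rewrite f0 add0r; exact: Mg.
Qed.

Lemma degree_clonoidMn M n (f : operation p n.+1) k :
  degree_clonoid M (FinOp f) -> degree_clonoid M (FinOp (f *+ k)).
Proof.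
move=> Mf e; rewrite coeffMn => ek; apply: Mf; apply: contraNneq ek => ->.
by rewrite mul0rn.
Qed.

Lemma degree_clonoid_sum M n I (r : seq I) (P : pred I)
    (F : I -> operation p n.+1) :
  (forall i, P i -> degree_clonoid M (FinOp (F i))) ->
  degree_clonoid M (FinOp (\sum_(i <- r | P i) F i)).
Proof.
move=> MF; apply: (big_ind (fun f => degree_clonoid M (FinOp f))) => //.
  exact: degree_clonoid0.
by move=> f g; exact: degree_clonoidD.
Qed.

Lemma degree_clonoid_reduced M n (e : {ffun 'I_n.+1 -> 'F_p}) :
  degree_clonoid M (FinOp (monomial p (expo e))) <-> M (\sum_i expo e i)%N.
Proof.
split=> [/(_ e)|Me e'].
  by rewrite coeff_reduced_monomial eqxx oner_neq0; exact.
by have [->|/negPf ee'] := eqVneq e' e; rewrite // coeff_reduced_monomial ee' eqxx.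
Qed.

(** Replacing x_i^k by x_i^(k-p+1) for some k >= p does not change the operation,
and the new degree is still in M because the old one exceeded p - 1. *)
Lemma degree_clonoid_monomial M n (m : 'I_n.+1 -> nat) :
  is_minor_subset p M -> M (\sum_i m i)%N ->
  degree_clonoid M (FinOp (monomial p m)).
Proof.
move=> minM; have p1 := prime_gt1 p_prime.
have [k] := ubnP (\sum_i m i)%N; elim: k m => // k IH m; rewrite ltnS => mk Mm.
have [/forallP mp|] := boolP [forall i, m i < p]%N.
  rewrite -(eq_monomial p (fin_expoK p_prime mp)); apply/degree_clonoid_reduced.
  by rewrite (eq_bigr m) // => i _; exact: fin_expoK.
rewrite negb_forall => /existsP[i]; rewrite -leqNgt => pm.
pose m' l := if l == i then (m i - p.-1)%N else m l.
have sm' : (\sum_l m' l = \sum_l m l - p.-1)%N.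
  rewrite (bigD1 i) //= [in RHS](bigD1 i) //= /m' eqxx.
  rewrite (eq_bigr m) => [|l /negPf-> //]; lia.
have dp : (p.-1 < \sum_l m l)%N by rewrite (bigD1 i) //=; lia.
have -> : monomial p m = monomial p m'.
  apply/ffunP => x; rewrite !ffunE; apply: eq_bigr => l _; rewrite /m'.
  case: eqP => [->|//]; rewrite -[in LHS](subnK pm) exprD Fp_expp // -exprSr.
  by congr (_ ^+ _); lia.
by apply: IH; rewrite sm'; [lia | exact: minM].
Qed.

Lemma degree_clonoid_homogeneous M n d (f : operation p n.+1) :
  is_minor_subset p M -> M d -> homogeneous d f -> degree_clonoid M (FinOp f).
Proof.
move=> minM + hf; elim: hf => {d f} [d _|d f g _ IHf _ IHg Md|m Md].
- exact: degree_clonoid0.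
- by apply: degree_clonoidD; [exact: IHf | exact: IHg].
- exact: degree_clonoid_monomial.
Qed.

(** On the left, a linear operation merely forms linear combinations. On the
right, it turns each monomial of f into a homogeneous operation of the same
degree. *)
Lemma degree_clonoidP M :
  is_minor_subset p M -> is_linearly_closed_clonoid (degree_clonoid M).
Proof.
move=> minM; split.
- by exists (FinOp (0 : operation p 1)); exact: degree_clonoid0.
- move=> _ [n [m [f [g [/linear_additive /= fD Mg ->]]]]].
  have -> : comp_operation f g = \sum_i g i *+ f (delta_mx 0 i).
    apply/ffunP => x; rewrite ffunE sum_ffunE additive_sum //.
    by apply: eq_bigr => i _; rewrite ffunMnE mulrn_Fp mxE.
  by apply: degree_clonoid_sum => i _; apply: degree_clonoidMn; exact: Mg.
- move=> _ [n [m [f [g [Mf Lg ->]]]]].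
  have -> : comp_operation f g =
      \sum_(e : {ffun 'I_n.+1 -> 'F_p})
         comp_operation (monomial p (expo e)) g *+ coeff e f.
    apply/ffunP => x; rewrite ffunE [in LHS](interpolation f) !sum_ffunE.
    by apply: eq_bigr => e _; rewrite !ffunMnE [in RHS]ffunE.
  apply: degree_clonoid_sum => e _.
  have [->|/Mf Me] := eqVneq (coeff e f) 0; first exact: degree_clonoid0.
  apply: degree_clonoidMn; apply: (degree_clonoid_homogeneous minM Me).
  have -> : comp_operation (monomial p (expo e)) g =
            [ffun x => \prod_i [ffun x => g i x ^+ expo e i] x].
    by apply/ffunP => x; rewrite !ffunE; apply: eq_bigr => i _; rewrite mxE ffunE.
  apply: homogeneous_prod => i; apply: homogeneousX; apply: homogeneous_additive.
  exact: linear_additive (Lg i).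
Qed.

(** The test operation is the product of d variables; a further dummy variable
keeps the arity positive when d = 0. *)
Lemma subset_degree_clonoid M M' :
  degree_clonoid M `<=` degree_clonoid M' -> M `<=` M'.
Proof.
move=> MM' d Md; have p1 := prime_gt1 p_prime.
pose m (i : 'I_d.+1) := ((i < d) : nat)%N.
have mp i : (m i < p)%N by exact: leq_ltn_trans (leq_b1 _) p1.
have sm : (\sum_i expo (fin_expo p m) i = d)%N.
  under eq_bigr => i _ do rewrite fin_expoK //.
  rewrite big_ord_recr /= /m ltnn addn0.
  by under eq_bigr => i _ do rewrite /= ltn_ord; rewrite sum1_card card_ord.
rewrite -sm; apply/degree_clonoid_reduced/MM'/degree_clonoid_reduced.
by rewrite sm.
Qed.

(** * The isomorphism *)

Section DegreesOfClonoid.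
Variables (D : set (finop p)) (clD : is_linearly_closed_clonoid D).

Definition degrees : set nat := [set d | exists n (m : 'I_n.+1 -> nat),
  [/\ forall i, (m i < p)%N, (\sum_i m i)%N = d & D (FinOp (monomial p m))]].

(** The witness of degree k is again the product of k variables with one dummy
variable. *)
Lemma degrees_minor : is_minor_subset p degrees.
Proof.
move=> _ [n [m [mp <- Dm]]] dp; have p1 := prime_gt1 p_prime.
pose k := (\sum_i m i - p.-1)%N.
exists k, (fun i : 'I_k.+1 => (i < k) : nat)%N.
have sk : (\sum_(i < k.+1) (i < k) = k)%N.
  rewrite big_ord_recr /= ltnn addn0.
  by under eq_bigr => i _ do rewrite /= ltn_ord; rewrite sum1_card card_ord.
have ltp (i : 'I_k.+1) : ((i < k)%N < p)%N by exact: leq_ltn_trans (leq_b1 _) p1.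
by split=> //; exact: (clonoid_degree_drop p_prime clD mp ltp).
Qed.

(** From left to right, each monomial of f has the degree of some monomial of D,
hence lies in D, and f is a combination of its monomials. From right to left, D
contains the monomials of its members. *)
Lemma degree_clonoid_degrees : degree_clonoid degrees = D.
Proof.
apply/seteqP; split=> -[n f] Df /=.
  rewrite -[existT _ n f]/(FinOp f) (interpolation f).
  apply: clonoid_sum => // e _.
  have [->|/Df [n' [m [mp sm Dm]]]] := eqVneq (coeff e f) 0.
    exact: (clonoid_muln clD 0 (clonoid_zero _ clD)).
  apply: clonoid_muln => //.
  apply: (clonoid_monomial_degree p_prime clD mp) Dm => //.
  by move=> i; exact: ltn_Fp.
move=> e ef; exists n, (expo e); split=> //; first by move=> i; exact: ltn_Fp.
exact: (clonoid_monomial p_prime clD Df).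
Qed.

End DegreesOfClonoid.

Definition degree_iso (M : minor_subset p) : linearly_closed_clonoid p :=
  LinearlyClosedClonoid (asboolT (degree_clonoidP (@minor_subsetP p M))).

Lemma le_degree_iso (M N : minor_subset p) :
  (degree_iso M <= degree_iso N)%O = (M <= N)%O.
Proof.
rewrite !leEsub; apply/idP/idP; rewrite !subsetEset /=.
  exact: subset_degree_clonoid.
by move=> MN [n f] Mf e /Mf /MN.
Qed.

Lemma degree_iso_surj (D : linearly_closed_clonoid p) :
  exists M : minor_subset p, degree_iso M = D.
Proof.
have clD := linearly_closed_clonoidP D.
exists (MinorSubset (asboolT (degrees_minor clD))).
apply: val_inj; exact: degree_clonoid_degrees.
Qed.

Lemma degree_iso_inj : injective degree_iso.
Proof. by move=> M N MN; apply: le_anti; rewrite -!le_degree_iso MN lexx. Qed.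

(** A surjection that preserves and reflects the order preserves meets and
joins: the bound of the images is itself an image, and compares with the image
of the bound as the preimages do. *)
Lemma degree_isoI : Order.meet_morphism degree_iso.
Proof.
move=> M N; apply: le_anti; rewrite lexI !le_degree_iso leIl leIr /=.
have [L eL] := degree_iso_surj (degree_iso M `&` degree_iso N)%O.
by rewrite -eL le_degree_iso lexI -!le_degree_iso eL leIl leIr.
Qed.

Lemma degree_isoU : Order.join_morphism degree_iso.
Proof.
move=> M N; apply: le_anti; rewrite leUx !le_degree_iso leUl leUr andbT.
have [L eL] := degree_iso_surj (degree_iso M `|` degree_iso N)%O.
by rewrite -eL le_degree_iso leUx -!le_degree_iso eL leUl leUr.
Qed.

Lemma degree_iso_homo : {homo degree_iso : L N / (L <= N)%O}.
Proof. by move=> L N; rewrite le_degree_iso. Qed.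

HB.instance Definition _ := Order.isOrderMorphism.Build _ _ _ _ degree_iso
  degree_iso_homo.
HB.instance Definition _ := Order.isLatticeMorphism.Build _ _ _ _ degree_iso
  degree_isoI degree_isoU.

End DegreeClonoid.

Theorem theorem1p2 (p : nat) (p_prime : prime p) :
  exists phi : {lmorphism minor_subset p -> linearly_closed_clonoid p},
    bijective phi.
Proof.
exists (degree_iso p_prime).
have [g gP] := choice (degree_iso_surj p_prime).
exists g => [M|D]; last exact: gP.
by apply: (degree_iso_inj (p_prime := p_prime)); exact: gP.
Qed.
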